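(* Let $I, J$ be two nonempty closed intervals in $\mathbb R$ and let $d$ be a positive integer. Then $$WG(J, I) = \{\varphi\colon J \to I \mid f \circ \varphi \in G(J, \mathbb R^d) \text{ for every } f \in G(I, \mathbb R^d)\}.$$
   Context: Closed intervals may be bounded or unbounded. For a nonempty closed interval $K \subset \mathbb R$, a function $f\colon K \to \mathbb R$ is called \emph{regulated} if, for every $t_0 \in K$ which is not the right endpoint of $K$, the lateral limit $f(t_0^+) = \lim_{t \to t_0^+} f(t)$ exists (in $\mathbb R$) and, for every $t_0 \in K$ which is not the left endpoint of $K$, the lateral limit $f(t_0^-) = \lim_{t \to t_0^-} f(t)$ exists (in $\mathbb R$). No boundedness of $f$ is required when $K$ is unbounded. A function with values in $\mathbb R^d$ is regulated if all its components are; $G(K, \mathbb R^d)$ is the set of regulated functions from $K$ to $\mathbb R^d$. A function $f\colon K \to \mathbb R$ is called \emph{well-regulated} if it is regulated and the following two properties hold. (i) For every $t_0 \in K$ which is not the right endpoint of $K$, there exists $\varepsilon > 0$ with $(t_0, t_0 + \varepsilon) \subset K$ such that one of the following holds: $f(t) > f(t_0^+)$ for every $t \in (t_0, t_0 + \varepsilon)$; or $f(t) = f(t_0^+)$ for every $t \in (t_0, t_0 + \varepsilon)$; or $f(t) < f(t_0^+)$ for every $t \in (t_0, t_0 + \varepsilon)$. (ii) For every $t_0 \in K$ which is not the left endpoint of $K$, there exists $\varepsilon > 0$ with $(t_0 - \varepsilon, t_0) \subset K$ such that one of the following holds: $f(t) > f(t_0^-)$ for every $t \in (t_0 - \varepsilon,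 t_0)$; or $f(t) = f(t_0^-)$ for every $t \in (t_0 - \varepsilon, t_0)$; or $f(t) < f(t_0^-)$ for every $t \in (t_0 - \varepsilon, t_0)$. For $I \subset \mathbb R$, $WG(K, I)$ is the set of well-regulated functions defined on $K$ and taking values in $I$. *)

(* Defs.v *)
From HB Require Import structures.
From mathcomp Require Import all_boot all_order all_algebra.
From mathcomp Require Import all_classical all_reals all_analysis.
Set Implicit Arguments.
Unset Strict Implicit.
Unset Printing Implicit Defensive.
Import Order.TTheory GRing.Theory Num.Theory.
Import numFieldNormedType.Exports.
Local Open Scope classical_set_scope.
Local Open Scope ring_scope.

(* A function on K : set R is represented by a total function on R, of which
   only the values on K matter.  In particular, if K is an interval and t0 in
   K is not its right (resp. left) endpoint, then K contains a one-sided
   neighbourhood of t0, so the lateral limit at t0^+ (resp. t0^-) of the total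
   function is the lateral limit of its restriction to K. *)

Definition closed_interval {R : realType} (K : set R) : Prop :=
  is_interval K /\ closed K.

Definition left_endpoint {R : realType} (K : set R) (t : R) : Prop :=
  K t /\ lbound K t.

Definition right_endpoint {R : realType} (K : set R) (t : R) : Prop :=
  K t /\ ubound K t.

Definition rlim {R : realType} (f : R -> R) (t0 : R) : R :=
  lim (f t @[t --> t0^'+]).

Definition llim {R : realType} (f : R -> R) (t0 : R) : R :=
  lim (f t @[t --> t0^'-]).

Definition regulated {R : realType} (K : set R) (f : R -> R) : Prop :=
  (forall t0, K t0 -> ~ right_endpoint K t0 -> cvg (f t @[t --> t0^'+])) /\
  (forall t0, K t0 -> ~ left_endpoint K t0 -> cvg (f t @[t --> t0^'-])).

Definition G {R : realType} (K : set R) (d : nat) : set (R -> 'rV[R]_d) :=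
  [set f : R -> 'rV[R]_d | forall i : 'I_d, regulated K (fun t => f t ord0 i)].
Arguments G {R} K d _.

Definition constant_sign_on {R : realType} (A : set R) (f : R -> R) (l : R) :
    Prop :=
  [\/ forall t, A t -> l < f t,
      forall t, A t -> f t = l
    | forall t, A t -> f t < l].

Definition well_regulated {R : realType} (K : set R) (f : R -> R) : Prop :=
  [/\ regulated K f,
      forall t0, K t0 -> ~ right_endpoint K t0 ->
        exists e : R, [/\ 0 < e, `]t0, t0 + e[ `<=` K
          & constant_sign_on `]t0, t0 + e[ f (rlim f t0)]
    & forall t0, K t0 -> ~ left_endpoint K t0 ->
        exists e : R, [/\ 0 < e, `]t0 - e, t0[ `<=` K
          & constant_sign_on `]t0 - e, t0[ f (llim f t0)]].

Definition WG {R : realType} (K I : set R) : set (R -> R) :=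
  [set f : R -> R | set_fun K I f /\ well_regulated K f].
Arguments WG {R} K I _.

(* Main.v *)
(* One-sided neighbourhoods are filters, so both sides of a point are treated
   at once. If phi tends to l along a filter while staying on one side of l
   (or equal to l), then f \o phi inherits a one-sided limit of f at l.
   Conversely, testing with the identity gives the limit l of phi, and testing
   with the indicators of the half-lines x > l and x < l shows that the signs
   "phi > l" and "phi < l" are each eventually decided, because a convergent
   0-1 valued function is eventually constant. *)
Require Import Defs.
From HB Require Import structures.
From mathcomp Require Import all_boot all_order all_algebra.
From mathcomp Require Import all_classical all_reals all_analysis.
From mathcomp Require Import lra.
Set Implicit Arguments.
Unset Strict Implicit.
Unset Printing Implicit Defensive.
Import Order.TTheory GRing.Theory Num.Theory.
Import numFieldNormedType.Exports.
Local Open Scope classical_set_scope.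
Local Open Scope ring_scope.

(** The filter form of [constant_sign_on], with [l] left free, so that a single argument covers both
    [t0^'+] and [t0^'-]. *)
Definition eventual_sign {R : realType} (F : set_system R) (f : R -> R)
    (l : R) : Prop :=
  [\/ \forall t \near F, l < f t,
      \forall t \near F, f t = l
    | \forall t \near F, f t < l].

Lemma at_rightE (R : realType) (t0 : R) (P : set R) :
  (\forall t \near t0^'+, P t) <->
  exists2 e : R, 0 < e & `]t0, t0 + e[ `<=` P.
Proof.
split=> [[e /= e0 H]|[e e0 H]].
  exists e => // t /=; rewrite in_itv/= => /andP[t0t tt0e].
  by apply: H => //=; rewrite ltr_norml; lra.
near=> t; apply: H; rewrite /= in_itv/=; apply/andP; split; near: t.
  exact: nbhs_right_gt.
by apply: nbhs_right_lt; rewrite ltrDl.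
Unshelve. all: by end_near. Qed.

Lemma at_leftE (R : realType) (t0 : R) (P : set R) :
  (\forall t \near t0^'-, P t) <->
  exists2 e : R, 0 < e & `]t0 - e, t0[ `<=` P.
Proof.
split=> [[e /= e0 H]|[e e0 H]].
  exists e => // t /=; rewrite in_itv/= => /andP[t0t tt0e].
  by apply: H => //=; rewrite ltr_norml; lra.
near=> t; apply: H; rewrite /= in_itv/=; apply/andP; split; near: t.
  by apply: nbhs_left_gt; rewrite ltrBlDr ltrDl.
exact: nbhs_left_lt.
Unshelve. all: by end_near. Qed.

Lemma near_right_interval (R : realType) (K : set R) (t0 : R) :
  is_interval K -> K t0 -> ~ right_endpoint K t0 ->
  \forall t \near t0^'+, K t.
Proof.
move=> iK Kt0 nr.
have [y Ky ty] : exists2 y, K y & t0 < y.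
  apply: contrapT => H; apply: nr; split=> // y Ky.
  by rewrite leNgt; apply/negP => ty; apply: H; exists y.
near=> t; apply: (iK t0 y) => //; apply/andP; split; apply: ltW; near: t.
  exact: nbhs_right_gt.
exact: nbhs_right_lt.
Unshelve. all: by end_near. Qed.

Lemma near_left_interval (R : realType) (K : set R) (t0 : R) :
  is_interval K -> K t0 -> ~ left_endpoint K t0 ->
  \forall t \near t0^'-, K t.
Proof.
move=> iK Kt0 nl.
have [y Ky yt] : exists2 y, K y & y < t0.
  apply: contrapT => H; apply: nl; split=> // y Ky.
  by rewrite leNgt; apply/negP => yt; apply: H; exists y.
near=> t; apply: (iK y t0) => //; apply/andP; split; apply: ltW; near: t.
  exact: nbhs_left_gt.
exact: nbhs_left_lt.
Unshelve. all: by end_near. Qed.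

Lemma eventual_sign_rightP (R : realType) (K : set R) (f : R -> R) (t0 l : R) :
  (\forall t \near t0^'+, K t) ->
  eventual_sign t0^'+ f l <->
  exists e : R, [/\ 0 < e, `]t0, t0 + e[ `<=` K
    & constant_sign_on `]t0, t0 + e[ f l].
Proof.
move=> nK; split=> [fl|[e [e0 _ fl]]].
  (* The radius must serve two purposes, so it is extracted from the intersection of [K] with the
     sign condition. *)
  have combine (P : set R) : (\forall t \near t0^'+, P t) ->
      exists e : R, [/\ 0 < e, `]t0, t0 + e[ `<=` K & `]t0, t0 + e[ `<=` P].
    move=> nP; have [e e0 H] := (at_rightE _ _).1 (filterI nK nP).
    by exists e; split=> // t /H[].
  by case: fl => /combine[e [e0 eK eP]]; exists e; split=> //;
    [apply: Or31|apply: Or32|apply: Or33].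
by case: fl => fl; [apply: Or31|apply: Or32|apply: Or33];
  apply/at_rightE; exists e.
Qed.

Lemma eventual_sign_leftP (R : realType) (K : set R) (f : R -> R) (t0 l : R) :
  (\forall t \near t0^'-, K t) ->
  eventual_sign t0^'- f l <->
  exists e : R, [/\ 0 < e, `]t0 - e, t0[ `<=` K
    & constant_sign_on `]t0 - e, t0[ f l].
Proof.
move=> nK; split=> [fl|[e [e0 _ fl]]].
  have combine (P : set R) : (\forall t \near t0^'-, P t) ->
      exists e : R, [/\ 0 < e, `]t0 - e, t0[ `<=` K & `]t0 - e, t0[ `<=` P].
    move=> nP; have [e e0 H] := (at_leftE _ _).1 (filterI nK nP).
    by exists e; split=> // t /H[].
  by case: fl => /combine[e [e0 eK eP]]; exists e; split=> //;
    [apply: Or31|apply: Or32|apply: Or33].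
by case: fl => fl; [apply: Or31|apply: Or32|apply: Or33];
  apply/at_leftE; exists e.
Qed.

(** Since [l^'+] and [l^'-] are traces of [nbhs l] on open half-lines, this upgrades convergence to
    [l] into one-sided convergence once [phi] stays on one side. *)
Lemma cvg_near_within (R : realType) (F : set_system R) (FF : Filter F)
    (phi : R -> R) (l : R) (D : set R) :
  phi @ F --> l -> (\forall t \near F, D (phi t)) ->
  phi @ F --> within D (nbhs l).
Proof.
move=> phil FD A /phil FA.
by apply: filterS2 FD FA => t Dt; apply.
Qed.

Lemma is_cvg_regulated_comp (R : realType) (F : set_system R)
    (FF : ProperFilter F) (I : set R) (phi f : R -> R) (l : R) :
  closed I -> (\forall t \near F, I (phi t)) -> phi @ F --> l ->
  eventual_sign F phi l -> regulated I f -> cvg (f (phi t) @[t --> F]).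
Proof.
move=> cI FI phil sgn [fr fl].
(* Regularity gives lateral limits only at points of [I]; closedness of [I] places [l] there. *)
have Il : I l by apply: (closed_cvg I cI FI l phil).
case: sgn => sgn.
(* The filter is proper, so [phi] actually attains a value of [I] above [l]. *)
- have nl : ~ right_endpoint I l.
    move=> [_ ubl]; have [t [lt It]] := filter_ex (filterI sgn FI).
    by have := ubl _ It; rewrite leNgt lt.
  have /cvg_ex[a fa] := fr l Il nl.
  apply: (cvgP a); apply: cvg_comp fa.
  exact: cvg_near_within.
(* Here the composite is eventually the constant [f l], whatever the lateral limits of [f] at [l]
   are. *)
- apply: (cvgP (f l)); apply: cvg_near_cst.
  by apply: filterS sgn => t ->.
- have nl : ~ left_endpoint I l.
    move=> [_ lbl]; have [t [lt It]] := filter_ex (filterI sgn FI).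
    by have := lbl _ It; rewrite leNgt lt.
  have /cvg_ex[a fa] := fl l Il nl.
  apply: (cvgP a); apply: cvg_comp fa.
  exact: cvg_near_within.
Qed.

Lemma cvg_indicator_decided (R : realType) (F : set_system R)
    (FF : Filter F) (b : R -> bool) :
  cvg (((b t)%:R : R) @[t --> F]) ->
  (\forall t \near F, b t) \/ (\forall t \near F, ~~ b t).
Proof.
move=> /cvg_ex[c /cvgrPdist_lt /(_ (2^-1)) H].
have {H} := H _; rewrite invr_gt0 ltr0n => /(_ isT) H.
(* A limit above 1/2 is more than 1/2 away from 0, and any other is at least 1/2 away from 1, so
   closeness within 1/2 excludes one of the two values. *)
case: (ltP 2^-1 c) => c2; [left|right]; near=> t;
  have : `|c - (b t)%:R| < 2^-1 by near: t.
all: by case: (b t) => //=; rewrite ltr_norml; lra.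
Unshelve. all: by end_near. Qed.

Lemma regulated_id (R : realType) (K : set R) : regulated K id.
Proof.
split=> t0 _ _; apply: (cvgP t0); first exact: cvg_at_right_filter.
exact: cvg_at_left_filter.
Qed.

Lemma regulated_gt (R : realType) (K : set R) (l : R) :
  regulated K (fun x : R => (l < x)%R%:R).
Proof.
split=> t0 _ _.
  (* At the jump [t0 = l] the right limit is 1 and the left limit is 0, hence [leP] here but [ltP]
     for the left side. *)
  have [lt0|t0l] := leP l t0.
    apply: (cvgP (1 : R)); apply: cvg_near_cst; near=> t.
    by rewrite (le_lt_trans lt0).
  apply: (cvgP (0 : R)); apply: cvg_near_cst; near=> t.
  rewrite ltNge (_ : t <= l)//; apply: ltW; near: t.
  exact: nbhs_right_lt.
have [lt0|t0l] := ltP l t0.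
  apply: (cvgP (1 : R)); apply: cvg_near_cst; near=> t.
  by rewrite (_ : l < t)//; near: t; exact: nbhs_left_gt.
apply: (cvgP (0 : R)); apply: cvg_near_cst; near=> t.
by rewrite ltNge (_ : t <= l)// (le_trans _ t0l)//; apply: ltW.
Unshelve. all: by end_near. Qed.

Lemma regulated_lt (R : realType) (K : set R) (l : R) :
  regulated K (fun x : R => (x < l)%R%:R).
Proof.
split=> t0 _ _.
  have [t0l|lt0] := ltP t0 l.
    apply: (cvgP (1 : R)); apply: cvg_near_cst; near=> t.
    by rewrite (_ : t < l)//; near: t; exact: nbhs_right_lt.
  apply: (cvgP (0 : R)); apply: cvg_near_cst; near=> t.
  by rewrite ltNge (_ : l <= t)// (le_trans lt0)//; apply: ltW.
have [t0l|lt0] := leP t0 l.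
  apply: (cvgP (1 : R)); apply: cvg_near_cst; near=> t.
  by rewrite (_ : t < l)// (lt_le_trans _ t0l).
apply: (cvgP (0 : R)); apply: cvg_near_cst; near=> t.
rewrite ltNge (_ : l <= t)//; apply: ltW; near: t.
exact: nbhs_left_gt.
Unshelve. all: by end_near. Qed.

Lemma eventual_sign_indicators (R : realType) (F : set_system R)
    (FF : Filter F) (phi : R -> R) (l : R) :
  cvg (((l < phi t)%R%:R : R) @[t --> F]) ->
  cvg (((phi t < l)%R%:R : R) @[t --> F]) ->
  eventual_sign F phi l.
Proof.
move=> /cvg_indicator_decided[gt|ngt]; first by move=> _; apply: Or31.
move=> /cvg_indicator_decided[lt|nlt]; first by apply: Or33.
(* Both strict inequalities eventually fail, which forces equality by antisymmetry. *)
apply: Or32; near=> t; apply/eqP; rewrite eq_le !leNgt.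
by apply/andP; split; near: t.
Unshelve. all: by end_near. Qed.

Theorem theorem2p5 (R : realType) (I J : set R) (d : nat)
    (hI : closed_interval I) (I0 : I !=set0)
    (hJ : closed_interval J) (J0 : J !=set0) (hd : (0 < d)%N) :
  WG J I =
  [set phi : R -> R | set_fun J I phi /\
     forall f : R -> 'rV[R]_d, G I d f -> G J d (f \o phi)].
Proof.
have [_ cI] := hI; have [iJ _] := hJ.
apply/seteqP; split=> phi /= [JI].
  move=> [[phir phil] sr sl]; split=> // f Gf i; split=> t0 Jt0 nt0.
    have nJ := near_right_interval iJ Jt0 nt0.
    (* [cvg] unfolds to convergence to [lim], so [l] is instantiated by [rlim phi t0], the value
       used in [well_regulated]. *)
    apply: is_cvg_regulated_comp (phir _ Jt0 nt0) _ (Gf i) => //.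
      by apply: filterS nJ => t /JI.
    exact/(eventual_sign_rightP _ _ nJ)/sr.
  have nJ := near_left_interval iJ Jt0 nt0.
  apply: is_cvg_regulated_comp (phil _ Jt0 nt0) _ (Gf i) => //.
    by apply: filterS nJ => t /JI.
  exact/(eventual_sign_leftP _ _ nJ)/sl.
move=> GIJ; split=> //.
(* Scalar test functions suffice: [g] is copied into all [d] components, and component 0, which
   exists by [hd], is read back. *)
have reg (g : R -> R) : regulated I g -> regulated J (g \o phi).
  move=> Ig; have := GIJ (fun t => const_mx (g t)).
  move=> /(_ _)/wrap[|/(_ (Ordinal hd))].
    move=> i; rewrite (_ : (fun t => _) = g)//.
    by apply/funext => t; rewrite mxE.
  rewrite (_ : (fun t => _) = g \o phi)//.
  by apply/funext => t; rewrite /= mxE.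
split; first exact: (reg id (regulated_id I)).
- move=> t0 Jt0 nt0.
  apply/eventual_sign_rightP; first exact: near_right_interval.
  (* The half-lines are cut at the lateral limit itself, so the test functions depend on [t0]. *)
  have [gtr _] := reg _ (regulated_gt I (rlim phi t0)).
  have [ltr _] := reg _ (regulated_lt I (rlim phi t0)).
  by apply: eventual_sign_indicators; [exact: gtr|exact: ltr].
- move=> t0 Jt0 nt0.
  apply/eventual_sign_leftP; first exact: near_left_interval.
  have [_ gtl] := reg _ (regulated_gt I (llim phi t0)).
  have [_ ltl] := reg _ (regulated_lt I (llim phi t0)).
  by apply: eventual_sign_indicators; [exact: gtl|exact: ltl].
Qed.
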